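(* Let $n\ge1$. The class of $(\langle\ \rangle;,\mathsf A_1,\dots,\mathsf A_n,\mathsf F_1,\dots,\mathsf F_n)$-algebras that are representable by $n$-ary partial functions is a quasivariety, finitely axiomatised by the following (quasi)equations (each universally quantified over all element variables occurring in it): (1) $\langle \boldsymbol a; b_1,\dots,\boldsymbol a; b_n\rangle ; c = \boldsymbol a;(\boldsymbol b; c)$; (2) $\boldsymbol\pi; a = a$; (3) $\langle \mathsf A_1^n a\rangle; a = 0$ (i.e. $\langle \mathsf A_1^n a\rangle; a=\langle \mathsf A_1^n b\rangle; b$ for all $a,b$, so that $0$ is a well-defined constant); (4) $\langle a_1,\dots,a_{i-1},0,a_{i+1},\dots,a_n\rangle; b = 0$ for every $i$; (5) $\boldsymbol a; 0 = 0$; (6) $\boldsymbol a;\mathsf A_i b = \langle \mathsf A_1^n(\boldsymbol a; b)\rangle;\langle \mathsf D_1^n a_1\rangle;\cdots;\langle \mathsf D_1^n a_n\rangle; a_i$ for every $i$; (7) $\langle \mathsf D_1^n a\rangle; b=\langle \mathsf D_1^n a\rangle; c \ \wedge\ \langle \mathsf A_1^n a\rangle; b=\langle \mathsf A_1^n a\rangle; c \ \rightarrow\ b=c$; (8) $\langle \mathsf D_1^n a\rangle; a = a$; (9) $\mathsf A_i\mathsf A_j a=\mathsf A_i\mathsf A_k a$ for every $i,j,k$; (10) $\mathsf D_i(\mathsf F_i a)=\mathsf F_i a$ for every $i$; (11) $\langle \mathsf D_1^n(\mathsf F_i a)\rangle; a=\mathsf F_i a$ for every $i$; (12) $\boldsymbol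 b; a=b_i\ \rightarrow\ \boldsymbol b;\mathsf F_i a=b_i$ for every $i$.
   Context: Fix $n\ge 1$; indices $i,j,k$ range over $\{1,\dots,n\}$. The signature has an $(n+1)$-ary operation (composition), written $\langle a_1,\dots,a_n\rangle ; b$, and unary operations $\mathsf A_1,\dots,\mathsf A_n,\mathsf F_1,\dots,\mathsf F_n$. Algebras are nonempty. An $n$-ary partial function on a set $X$ is a set $f\subseteq X^{n+1}$ such that $(\boldsymbol x,y),(\boldsymbol x,z)\in f$ implies $y=z$ (where $\boldsymbol x\in X^n$). An algebra of $n$-ary partial functions of this signature is an algebra whose elements are $n$-ary partial functions, for which there are a set $X$ (the base) and an equivalence relation $E$ on $X$ such that every tuple $(x_1,\dots,x_{n+1})$ in every element lies in $X^{n+1}$ and has pairwise $E$-equivalent entries, and whose operations are $\boldsymbol f; g=\{(\boldsymbol x,z)\in X^{n+1} : \exists \boldsymbol y\in X^n,\ (\boldsymbol x,y_i)\in f_i \text{ for each } i \text{ and } (\boldsymbol y,z)\in g\}$, $\mathsf A_i(f)=\{(\boldsymbol x,x_i)\in X^{n+1} : x_1,\dots,x_n \text{ all } E\text{-equivalent and there is no } y\in X \text{ with } (\boldsymbol x,y)\in f\}$, $\mathsf F_i(f)=\{(\boldsymbol x,x_i)\in X^{n+1} : (\boldsymbol x,x_i)\in f\}$ (fixset). An algebra is representable by $n$-ary partial functions if it is isomorphic to an algebra of $n$-ary partial functions of the same signature. Notation: a bold symbol $\boldsymbol a$ in a term $\boldsymbol a; b$ stands for $\langle a_1,\dots,a_n\rangle$;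 unbracketed compositions associate to the right ($\boldsymbol a;\boldsymbol b; c=\boldsymbol a;(\boldsymbol b; c)$); for unary operations $\mathsf B_1,\dots,\mathsf B_n$, $\langle \mathsf B_1^n a\rangle$ means $\langle \mathsf B_1 a,\dots,\mathsf B_n a\rangle$. Abbreviations: $0:=\langle \mathsf A_1^n b\rangle; b$ for any $b$; $\pi_i:=\mathsf A_i 0$; $\boldsymbol\pi:=\langle\pi_1,\dots,\pi_n\rangle$; $\mathsf D_i a:=\mathsf A_i\mathsf A_i a$. *)

(* Defs.v *)
From Stdlib Require Import RelationClasses.
From Stdlib Require List.
From mathcomp Require Import all_boot.
From mathcomp Require Import classical_sets.

Set Implicit Arguments.
Unset Strict Implicit.
Unset Printing Implicit Defensive.

Local Open Scope classical_set_scope.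

(** * Algebras of the signature *)

Record algebra (n : nat) := Algebra {
  carrier :> Type;
  carrier_nonempty : inhabited carrier;
  comp : ('I_n -> carrier) -> carrier -> carrier;
  antidom : 'I_n -> carrier -> carrier;
  fixset : 'I_n -> carrier -> carrier }.

Definition isomorphism n (A B : algebra n) (h : A -> B) : Prop :=
  [/\ bijective h,
      forall (a : 'I_n -> A) (b : A), h (comp a b) = comp (fun i => h (a i)) (h b),
      forall i (a : A), h (antidom i a) = antidom i (h a) &
      forall i (a : A), h (fixset i a) = fixset i (h a)].

(** * Terms and quasiequations *)

(* [Var k i] is a doubly indexed supply of distinct variables, so that tuples
   of variables such as [a_1, ..., a_n] are available. *)
Inductive term (n : nat) : Type :=
| Var of nat & nat
| Comp of ('I_n -> term n) & term n
| Anti of 'I_n & term n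
| Fixs of 'I_n & term n.

Arguments Var {n} k i.

Fixpoint eval n (A : algebra n) (v : nat -> nat -> A) (t : term n) : A :=
  match t with
  | Var k i => v k i
  | Comp s u => comp (fun i => eval v (s i)) (eval v u)
  | Anti i u => antidom i (eval v u)
  | Fixs i u => fixset i (eval v u)
  end.

Record equation (n : nat) := Equation { lhs : term n; rhs : term n }.

Record quasiequation (n : nat) := Quasiequation {
  premises : seq (equation n);
  conclusion : equation n }.

Definition holds n (A : algebra n) (v : nat -> nat -> A) (e : equation n) : Prop :=
  eval v (lhs e) = eval v (rhs e).

Definition satisfies n (A : algebra n) (q : quasiequation n) : Prop :=
  forall v : nat -> nat -> A,
    List.Forall (holds v) (premises q) -> holds v (conclusion q).

Definition axiomatised_by n (K : algebra n -> Prop) (Q : set (quasiequation n)) : Prop :=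
  forall A : algebra n, K A <-> (forall q, Q q -> satisfies A q).

Definition quasivariety n (K : algebra n -> Prop) : Prop :=
  exists Q : set (quasiequation n), axiomatised_by K Q.

Definition finitely_axiomatised_by n (K : algebra n -> Prop)
    (s : seq (quasiequation n)) : Prop :=
  axiomatised_by K [set q | List.In q s].

(** * Algebras of n-ary partial functions *)

(* An (n+1)-tuple over X is split as its first n entries and its last one. *)
Definition nrel (n : nat) (X : Type) := set (('I_n -> X) * X).

Section ConcreteOperations.
Variables (n : nat) (X : Type) (E : X -> X -> Prop).

Definition partial_function (f : nrel n X) : Prop :=
  forall x y z, f (x, y) -> f (x, z) -> y = z.

Definition all_equiv (x : 'I_n -> X) : Prop := forall i j, E (x i) (x j).

Definition within_classes (f : nrel n X) : Prop :=
  forall x y, f (x, y) -> all_equiv x /\ (forall i, E (x i) y).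

Definition pf_comp (f : 'I_n -> nrel n X) (g : nrel n X) : nrel n X :=
  [set xz | exists y : 'I_n -> X, (forall i, f i (xz.1, y i)) /\ g (y, xz.2)].

Definition pf_antidom (i : 'I_n) (f : nrel n X) : nrel n X :=
  [set xz | xz.2 = xz.1 i /\ all_equiv xz.1 /\ ~ (exists y : X, f (xz.1, y))].

Definition pf_fixset (i : 'I_n) (f : nrel n X) : nrel n X :=
  [set xz | xz.2 = xz.1 i /\ f (xz.1, xz.1 i)].

End ConcreteOperations.

(* The base may be empty, but the set of elements may not. *)
Record pf_algebra (n : nat) := PFAlgebra {
  base : Type;
  base_rel : base -> base -> Prop;
  base_rel_equiv : Equivalence base_rel;
  elements : set (nrel n base);
  elements_nonempty : exists f, elements f;
  elements_pf : forall f, elements f -> partial_function f;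
  elements_within : forall f, elements f -> within_classes base_rel f;
  elements_comp : forall f g, (forall i, elements (f i)) -> elements g ->
    elements (pf_comp f g);
  elements_antidom : forall i f, elements f -> elements (pf_antidom base_rel i f);
  elements_fixset : forall i f, elements f -> elements (pf_fixset i f) }.

Section AlgebraOfPF.
Variables (n : nat) (P : pf_algebra n).

Definition pf_carrier : Type := {f : nrel n (base P) | elements f}.

Lemma pf_carrier_nonempty : inhabited pf_carrier.
Proof. by have [f Pf] := elements_nonempty P; exact: inhabits (exist _ f Pf). Qed.

Definition algebra_of_pf : algebra n :=
  @Algebra n pf_carrier pf_carrier_nonempty
    (fun f g => exist _ (pf_comp (fun i => sval (f i)) (sval g))
                  (elements_comp (fun i => svalP (f i)) (svalP g)))
    (fun i f => exist _ (pf_antidom (@base_rel n P) i (sval f))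
                  (elements_antidom i (svalP f)))
    (fun i f => exist _ (pf_fixset i (sval f)) (elements_fixset i (svalP f))).

End AlgebraOfPF.

Definition representable n (A : algebra n) : Prop :=
  exists (P : pf_algebra n) (h : A -> algebra_of_pf P), isomorphism h.

(** * The axioms *)

Declare Scope nterm_scope.
Delimit Scope nterm_scope with nterm.
Local Open Scope nterm_scope.
Notation "s ;; t" := (Comp s t) (at level 61, right associativity) : nterm_scope.
Notation "s =' t" := (Equation s t) (at level 70, no associativity) : nterm_scope.

Section QuasiequationalBasis.
Variable n : nat.
Implicit Types (i j k : 'I_n) (t : term n).

Definition Dom i t : term n := Anti i (Anti i t).
Definition Antis t : 'I_n -> term n := fun i => Anti i t.
Definition Doms t : 'I_n -> term n := fun i => Dom i t.

(* [vas], [vbs] are the tuples (a_1, ..., a_n), (b_1, ..., b_n); [va], [vb], [vc]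
   are the single variables a, b, c. *)
Definition vas i : term n := Var 0 i.
Definition vbs i : term n := Var 1 i.
Definition va : term n := Var 2 0.
Definition vb : term n := Var 2 1.
Definition vc : term n := Var 2 2.
(* [vz] occurs in no axiom except through [zero], so quantifying over valuations
   makes [zero] stand for <A_1^n b>; b with b arbitrary; [ax3] identifies all
   these choices. *)
Definition vz : term n := Var 3 0.

Definition zero : term n := Antis vz ;; vz.
Definition proj i : term n := Anti i zero.

Definition eqn (e : equation n) : quasiequation n := Quasiequation [::] e.

Definition ax1 := eqn ((fun i => vas ;; vbs i) ;; vc =' vas ;; vbs ;; vc).
Definition ax2 := eqn (proj ;; va =' va).
Definition ax3 := eqn (Antis va ;; va =' Antis vb ;; vb).
Definition ax4 i := eqn ((fun j => if j == i then zero else vas j) ;; vb =' zero).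
Definition ax5 := eqn (vas ;; zero =' zero).
Definition ax6 i :=
  eqn (vas ;; Anti i vb ='
       Antis (vas ;; vb) ;; foldr (fun j t => Doms (vas j) ;; t) (vas i) (enum 'I_n)).
Definition ax7 :=
  Quasiequation [:: Doms va ;; vb =' Doms va ;; vc; Antis va ;; vb =' Antis va ;; vc]
    (vb =' vc).
Definition ax8 := eqn (Doms va ;; va =' va).
Definition ax9 i j k := eqn (Anti i (Anti j va) =' Anti i (Anti k va)).
Definition ax10 i := eqn (Dom i (Fixs i va) =' Fixs i va).
Definition ax11 i := eqn (Doms (Fixs i va) ;; va =' Fixs i va).
Definition ax12 i := Quasiequation [:: vbs ;; va =' vbs i] (vbs ;; Fixs i va =' vbs i).

Definition each (F : 'I_n -> seq (quasiequation n)) : seq (quasiequation n) :=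
  flatten [seq F i | i <- enum 'I_n].

Definition axioms : seq (quasiequation n) :=
  [:: ax1; ax2; ax3] ++ each (fun i => [:: ax4 i]) ++ [:: ax5]
  ++ each (fun i => [:: ax6 i]) ++ [:: ax7; ax8]
  ++ each (fun i => each (fun j => each (fun k => [:: ax9 i j k])))
  ++ each (fun i => [:: ax10 i; ax11 i; ax12 i]).

End QuasiequationalBasis.

(* Main.v *)
From Pilot Require Import Defs.
From mathcomp Require Import all_boot.
From Stdlib Require List.
From mathcomp Require Import boolp classical_sets.
Import Pilot.Defs.

Set Implicit Arguments.
Unset Strict Implicit.
Unset Printing Implicit Defensive.

(** Soundness is a pointwise verification: in an algebra of partial functions
    the tuple [antis a] is the identity on the class-internal tuples outside the
    domain of [a], and [doms a] is the identity on the domain of [a].  Validity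
    of quasiequations passes along isomorphisms ([satisfies_isomorphism]).

    For completeness, call [antis a] the guard of [a] and let it act on the
    algebra by composition on the left, where it restricts functions to the
    complement of the domain of [a].  The axioms make guards commuting
    idempotents ([antis_idem], [antis_comm]), with [antis a] and [doms a]
    complementary: their product is zero, and two elements on which both act
    alike are equal.  The guards therefore behave like a Boolean algebra, and an
    ultrafilter [U] of guards plays the part of an argument tuple.  Two elements
    have the same germ at [U] when some finite product of guards from [U] makes
    them equal.  Germs are compatible with composition, and the base of the
    representation consists of all pairs of an ultrafilter and a nonzero germ
    there; two points are equivalent when their ultrafilters agree.  An element
    [f] sends the tuple of the germs of [a_1, ..., a_n] to the germ of
    [a ;; f] whenever that germ is not zero ([repr]).

    That [repr] preserves the operations comes down to what happens to
    [a ;; antidom i b] at one ultrafilter: its germ is that of [a i] if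
    [a ;; b] has germ zero, and zero otherwise ([germ_comp_antidom],
    [germ_comp_antidom_o]).  The fixsets are handled by reading
    [fixset i f] as a domain element and as a restriction of [f]
    ([germ_fixset]), and, for the converse, by applying the quasiequation for
    fixsets to a restricted tuple ([germ_fixset_intro]).  Faithfulness is the
    prime ideal argument of [separation]: if [b <> c], a maximal set of guards
    that does not identify [b] with [c] is an ultrafilter, and [b], [c] then
    take different values at the germs of the projections. *)

Local Notation "a ;; b" := (Defs.comp a b).

(** * The axioms as statements about operations *)

Section Tuples.
Variables (n : nat) (A : algebra n).

Definition antis (a : A) : 'I_n -> A := fun i => antidom i a.
Definition doms (a : A) : 'I_n -> A := fun i => antidom i (antidom i a).
Definition nought (w : A) : A := antis w ;; w.

End Tuples.

(** The constant zero is not part of the signature, so each axiom that mentions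
    it is quantified over the element [w] from which [nought w] is built. *)
Record basis n (A : algebra n) : Prop := Basis {
  compA : forall (a b : 'I_n -> A) c, (fun i => a ;; b i) ;; c = a ;; (b ;; c);
  projs_comp : forall w a : A, antis (nought w) ;; a = a;
  nought_const : forall a b : A, nought a = nought b;
  comp_noughtl : forall (w : A) i a b,
    (fun j => if j == i then nought w else a j) ;; b = nought w;
  comp_noughtr : forall (w : A) a, a ;; nought w = nought w;
  comp_antidom : forall i a (b : A),
    a ;; antidom i b
      = antis (a ;; b) ;; foldr (fun j t => doms (a j) ;; t) (a i) (enum 'I_n);
  guards_separate : forall a b c : A,
    doms a ;; b = doms a ;; c -> antis a ;; b = antis a ;; c -> b = c;
  doms_comp : forall a : A, doms a ;; a = a;
  antidom2 : forall i j k (a : A),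
    antidom i (antidom j a) = antidom i (antidom k a);
  dom_fixset : forall i (a : A), antidom i (antidom i (fixset i a)) = fixset i a;
  doms_fixset : forall i (a : A), doms (fixset i a) ;; a = fixset i a;
  comp_fixset : forall i (a : A) b, b ;; a = b i -> b ;; fixset i a = b i }.

Lemma In_mem (T : eqType) (x : T) s : x \in s -> List.In x s.
Proof.
elim: s => //= y s IHs; rewrite inE => /orP[/eqP->|/IHs]; by [left | right].
Qed.

Lemma Forall_cat (T : Type) (P : T -> Prop) s t :
  List.Forall P (s ++ t) <-> List.Forall P s /\ List.Forall P t.
Proof. exact: List.Forall_app. Qed.

Lemma Forall_each n (Phi : quasiequation n -> Prop) F :
  List.Forall Phi (each F) <-> forall i, List.Forall Phi (F i).
Proof.
split=> [H i|H]; rewrite /each in H *.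
  have := In_mem (mem_enum 'I_n i); elim: (enum 'I_n) H => //= j l IHl.
  by rewrite Forall_cat => -[Hj Hl] [<- //|]; exact: IHl.
elim: (enum 'I_n) => [|j l IHl] /=; first exact: List.Forall_nil.
by rewrite Forall_cat.
Qed.

Section Basis.
Variables (n : nat) (A : algebra n).

Lemma eval_foldr_doms (v : nat -> nat -> A) (i : 'I_n) l :
  eval v (foldr (fun (j : 'I_n) t => Comp (Doms (vas j)) t) (vas i) l)
    = foldr (fun (j : 'I_n) t => doms (v 0 j) ;; t) (v 0 i) l.
Proof. by elim: l => //= j l ->. Qed.

(** A tuple as a sequence of values for the variables [Var k 0], [Var k 1] and
    so on, with [w] beyond its length. *)
Definition pad (a : 'I_n -> A) (w : A) : nat -> A :=
  fun m => if insub m is Some i then a i else w.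

Lemma pad_ord a w (i : 'I_n) : pad a w i = a i.
Proof. by rewrite /pad valK. Qed.

Lemma pad_fun a w : (fun i : 'I_n => pad a w i) = a.
Proof. by apply: funext => i; exact: pad_ord. Qed.

Definition valuation (a b : 'I_n -> A) (x y z w : A) : nat -> nat -> A :=
  fun k => match k with
  | 0 => pad a w
  | 1 => pad b w
  | 2 => nth w [:: x; y; z]
  | _ => fun=> w
  end.

Lemma axioms_Forall (Phi : quasiequation n -> Prop) :
  (forall q, List.In q (axioms n) -> Phi q) <->
  [/\ [/\ Phi (ax1 n), Phi (ax2 n), Phi (ax3 n) & forall i, Phi (ax4 i)],
      [/\ Phi (ax5 n), forall i, Phi (ax6 i), Phi (ax7 n) & Phi (ax8 n)] &
      [/\ forall i j k, Phi (ax9 i j k), forall i, Phi (ax10 i),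
          forall i, Phi (ax11 i) & forall i, Phi (ax12 i)]].
Proof.
have F1 q : List.Forall Phi [:: q] <-> Phi q.
  by split=> [/List.Forall_cons_iff[]|] //; do 2?constructor.
rewrite -List.Forall_forall /axioms !Forall_cat !List.Forall_cons_iff.
rewrite !Forall_each; split.
  move=> [[? [? [? _]]] [H4 [[? _] [H6 [[? [? _]] [H9 H]]]]]].
  have{}H i : [/\ Phi (ax10 i), Phi (ax11 i) & Phi (ax12 i)].
    by have := H i; rewrite !List.Forall_cons_iff => -[? [? []]].
  split; split=> // i; do ?[exact/F1|by have [] := H i].
  move=> j k; have := H9 i; rewrite Forall_each => /(_ j).
  by rewrite Forall_each => /(_ k)/F1.
move=> [[? ? ? H4] [? H6 ? ?] [H9 H10 H11 H12]]; do !split=> //.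
all: try by do ?constructor.
all: move=> i; do ?[exact/F1].
by apply/Forall_each => j; apply/Forall_each => k; exact/F1.
Qed.

Lemma basisP : (forall q, List.In q (axioms n) -> satisfies A q) <-> basis A.
Proof.
rewrite axioms_Forall; split; last first.
  move=> bA; split; split.
  - by move=> v _; exact: compA bA _ _ _.
  - by move=> v _; exact: projs_comp bA _ _.
  - by move=> v _; exact: nought_const bA _ _.
  - move=> i v _; rewrite /holds.
    rewrite -[RHS](comp_noughtl bA (v 3 0) i (fun j => v 0 j) (v 2 1)).
    by congr (_ ;; _); apply: funext => j; case: eqP.
  - by move=> v _; exact: comp_noughtr bA _ _.
  - move=> i v _; rewrite /holds /= eval_foldr_doms.
    exact: (comp_antidom bA i (fun j => v 0 j)).
  - move=> v /List.Forall_cons_iff[Hd /List.Forall_cons_iff[Ha _]].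
    by have := guards_separate bA Hd Ha.
  - by move=> v _; exact: doms_comp bA _.
  - by move=> i j k v _; exact: antidom2 bA _ _ _ _.
  - by move=> i v _; exact: dom_fixset bA _ _.
  - by move=> i v _; exact: doms_fixset bA _ _.
  - move=> i v /List.Forall_cons_iff[H _].
    by have := comp_fixset bA (b := fun j => v 1 j) H.
move=> [[H1 H2 H3 H4] [H5 H6 H7 H8] [H9 H10 H11 H12]].
have hyp0 v : List.Forall (@holds n A v) [::] by exact: List.Forall_nil.
split.
- move=> a b c; have := H1 (valuation a b c c c c) (hyp0 _).
  by rewrite /holds /= !pad_fun; under eq_fun do rewrite pad_ord.
- by move=> w a; exact: (H2 (valuation (fun=> a) (fun=> a) a a a w) (hyp0 _)).
- by move=> a b; exact: (H3 (valuation (fun=> a) (fun=> a) a b a a) (hyp0 _)).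
- move=> w i a b; rewrite -[RHS](H4 i (valuation a a b b b w) (hyp0 _)) /=.
  congr (_ ;; _); apply: funext => j.
  by case: eqP => // _; rewrite /= pad_ord.
- move=> w a; have := H5 (valuation a a w w w w) (hyp0 _).
  by rewrite /holds /= pad_fun.
- move=> i a b; have := H6 i (valuation a a b b b b) (hyp0 _).
  rewrite /holds /= eval_foldr_doms pad_fun /= pad_ord => ->.
  by congr (_ ;; _); elim: (enum _) => //= j l ->; rewrite pad_ord.
- move=> a b c Hd Ha; apply: (H7 (valuation (fun=> a) (fun=> a) a b c c)).
  by do !constructor.
- by move=> a; exact: (H8 (valuation (fun=> a) (fun=> a) a a a a) (hyp0 _)).
- move=> i j k a.
  exact: (H9 i j k (valuation (fun=> a) (fun=> a) a a a a) (hyp0 _)).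
- move=> i a.
  exact: (H10 i (valuation (fun=> a) (fun=> a) a a a a) (hyp0 _)).
- move=> i a.
  exact: (H11 i (valuation (fun=> a) (fun=> a) a a a a) (hyp0 _)).
- move=> i a b Hb; have := H12 i (valuation b b a a a a).
  rewrite /holds /= pad_fun pad_ord; apply; do !constructor.
  by rewrite /holds /= pad_fun pad_ord.
Qed.
End Basis.

(** * Soundness *)

Section Soundness.
Variables (n : nat) (i0 : 'I_n) (P : pf_algebra n).
Local Notation B := (algebra_of_pf P).
Local Notation E := (@base_rel n P).
Implicit Types (f g : B) (x : 'I_n -> base P) (z : base P).

Lemma pf_ext f g :
  (forall x z, sval f (x, z) <-> sval g (x, z)) -> f = g.
Proof.
move=> fg; apply: eq_sig_hprop => [? ? ?|]; first exact: Prop_irrelevance.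
by apply/predeqP => -[x z]; exact: fg.
Qed.

Lemma pf_within f x z : sval f (x, z) -> all_equiv E x /\ (forall i, E (x i) z).
Proof. exact: (elements_within (svalP f)). Qed.

Lemma pf_fun f x y z : sval f (x, y) -> sval f (x, z) -> y = z.
Proof. exact: (elements_pf (svalP f)). Qed.

(** The entries of [y] are all related to the entry [x i0], since every graph
    stays within a class. *)
Lemma all_equiv_tuple x y (b : 'I_n -> B) :
  (forall i, sval (b i) (x, y i)) -> all_equiv E x /\ all_equiv E y.
Proof.
have [_ Es Et] := base_rel_equiv P.
move=> bxy; split=> [|i j]; first by have [] := pf_within (bxy i0).
have [_ /(_ i0) Ei] := pf_within (bxy i).
have [_ /(_ i0) Ej] := pf_within (bxy j).
exact: Et (Es _ _ Ei) Ej.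
Qed.

(** The domain tuple does not depend on the index of the inner antidomain,
    which is what makes [antidom2] sound. *)
Lemma pf_domE i j f x z :
  sval (antidom i (antidom j f)) (x, z) <-> z = x i /\ exists y, sval f (x, y).
Proof.
split=> [[/= -> [xE nA]]|[-> fx]].
  split=> //; apply: contrapT => nf; apply: nA; exists (x j).
  by split.
have [y fxy] := fx; have [xE _] := pf_within fxy.
by do 2!split=> //; move=> [y' [_ [_]]].
Qed.

Lemma pf_antis_compE f g x z :
  sval (antis f ;; g) (x, z) <-> (~ exists y, sval f (x, y)) /\ sval g (x, z).
Proof.
split=> [[y /= [fy gy]]|[nf gx]].
  have yx : y = x by apply: funext => i; have [] := fy i.
  by rewrite yx in gy; have [_ [_]] := fy i0.
have [xE _] := pf_within gx.
by exists x; split=> // i; do 2!split=> //.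
Qed.

Lemma pf_doms_compE f g x z :
  sval (doms f ;; g) (x, z) <-> (exists y, sval f (x, y)) /\ sval g (x, z).
Proof.
split=> [[y /= [fy gy]]|[fx gx]].
  have yx : y = x.
    by apply: funext => i; have [] := (pf_domE _ _ _ _ _).1 (fy i).
  by rewrite yx in gy; have [] := (pf_domE _ _ _ _ _).1 (fy i0).
by exists x; split=> // i; apply/pf_domE.
Qed.

Lemma pf_noughtF f x z : ~ sval (nought f) (x, z).
Proof. by move=> /pf_antis_compE[nf fx]; apply: nf; exists z. Qed.

Lemma pf_foldr_domsE (a : 'I_n -> B) g x z s :
  sval (foldr (fun j t => doms (a j) ;; t) g s) (x, z)
    <-> (forall j, j \in s -> exists y, sval (a j) (x, y)) /\ sval g (x, z).
Proof.
elim: s => [|j s IHs]; first by split=> // -[].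
apply: iff_trans (pf_doms_compE _ _ _ _) _; rewrite IHs; split.
  by move=> [ax [sx gx]]; split=> // k; rewrite inE => /orP[/eqP->|/sx].
move=> [sx gx]; split; first by apply: sx; rewrite mem_head.
by split=> // k ks; apply: sx; rewrite inE ks orbT.
Qed.

Lemma pf_basis : basis B.
Proof.
split.
- move=> a b c; apply: pf_ext => x z; split.
    move=> [y [/= aby cy]].
    (* The middle tuples found for the components coincide because each of them
       is computed by the same partial functions [a]. *)
    have [u [au bu]] : exists u, (forall i, sval (a i) (x, u i)) /\
        forall i, sval (b i) (u, y i).
      have /choice[v av] := aby; exists (v i0); split=> [i|i].
        by have [] := av i0.
      have [avi bvi] := av i; suff <- : v i = v i0 by [].
      apply: funext => k; exact: pf_fun (avi k) ((av i0).1 k).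
    by exists u; split=> //; exists y.
  move=> [u [au [y [bu cy]]]]; exists y; split=> // i.
  by exists u; split=> // k; exact: bu.
- move=> w a; apply: pf_ext => x z; rewrite pf_antis_compE.
  by split=> [[]//|ax]; split=> // -[y /pf_noughtF].
- by move=> a b; apply: pf_ext => x z; split=> /pf_noughtF.
- move=> w i a b; apply: pf_ext => x z; split=> [[y [/= /(_ i)]]|/pf_noughtF//].
  by rewrite eqxx => /pf_noughtF.
- by move=> w a; apply: pf_ext => x z; split=> [[y [_ /pf_noughtF]]|/pf_noughtF].
- move=> i a b; apply: pf_ext => x z; rewrite pf_antis_compE pf_foldr_domsE; split.
    move=> [y [/= ay [/= -> [yE nb]]]]; split; last first.
      by split=> // j _; exists (y j).
    move=> [u [y' [/= ay' bu]]]; apply: nb; exists u.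
    suff -> : y = y' by [].
    by apply: funext => k; exact: pf_fun (ay k) (ay' k).
  move=> [nab [ax axz]].
  have /choice[y ay] : forall j, exists y, sval (a j) (x, y).
    by move=> j; apply: ax; rewrite mem_enum.
  exists y; split=> //; split=> /=; first exact: pf_fun axz (ay i).
  have [_ yE] := all_equiv_tuple ay.
  by split=> // -[u bu]; apply: nab; exists u, y.
- move=> a b c Dbc Abc; apply: pf_ext => x z.
  have [ax|nax] := pselect (exists y, sval a (x, y)).
    have : sval (doms a ;; b) (x, z) <-> sval (doms a ;; c) (x, z) by rewrite Dbc.
    by rewrite !pf_doms_compE; tauto.
  have : sval (antis a ;; b) (x, z) <-> sval (antis a ;; c) (x, z) by rewrite Abc.
  by rewrite !pf_antis_compE; tauto.
- move=> a; apply: pf_ext => x z; rewrite pf_doms_compE.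
  by split=> [[]//|ax]; split=> //; exists z.
- by move=> i j k a; apply: pf_ext => x z; rewrite !pf_domE.
- move=> i a; apply: pf_ext => x z; rewrite pf_domE.
  by split=> [[-> [y [/= _ ?]]]//|[/= -> ?]]; split=> //; exists (x i).
- move=> i a; apply: pf_ext => x z; rewrite pf_doms_compE; split.
    move=> [[y [/= _ axi]] axz]; split=> //=; exact: pf_fun axz axi.
  by move=> [/= -> axi]; split=> //; exists (x i).
- move=> i a b bab; apply: pf_ext => x z; split.
    by move=> [y [/= by_ [/= -> _]]].
  rewrite -{1}bab => -[y [/= by_ ayz]]; exists y; split=> //.
  have yz : y i = z.
    by apply: pf_fun (by_ i) _; rewrite -bab; exists y.
  by split=> /=; rewrite yz.
Qed.

End Soundness.

Section Transfer.
Variables (n : nat) (A B : algebra n) (h : A -> B).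
Hypothesis hI : isomorphism h.

Lemma eval_isomorphism v (t : term n) :
  h (eval v t) = eval (fun k i => h (v k i)) t.
Proof.
have [_ hC hA hF] := hI.
elim: t => [k i|s IHs u IHu|i u IHu|i u IHu] //=.
- by rewrite hC IHu; congr (_ ;; _); apply: funext => i; exact: IHs.
- by rewrite hA IHu.
- by rewrite hF IHu.
Qed.

Lemma satisfies_isomorphism q : satisfies B q -> satisfies A q.
Proof.
have [/bij_inj h_inj _ _ _] := hI.
move=> Bq v vq; apply: h_inj; rewrite !eval_isomorphism; apply: Bq.
by apply: List.Forall_impl vq => e; rewrite /holds -!eval_isomorphism => ->.
Qed.

End Transfer.

(** * Guards *)

Section Completeness.
Variables (n : nat) (i0 : 'I_n) (A : algebra n) (w : A).
Hypothesis bA : basis A.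
Local Notation o := (nought w).
Implicit Types (a b c x y : A) (s t : seq A) (U : set A).

Lemma antis_comp a : antis a ;; a = o.
Proof. exact: nought_const bA a w. Qed.

Lemma comp_o (a : 'I_n -> A) : a ;; o = o.
Proof. exact: comp_noughtr bA _ _. Qed.

Lemma comp_has_o (a : 'I_n -> A) i b : a i = o -> a ;; b = o.
Proof.
move=> aio; rewrite -[RHS](comp_noughtl bA w i a b); congr (_ ;; _).
by apply: funext => j; case: eqP => // ->.
Qed.

(** Hence everything proved of guards holds of domain tuples as well. *)
Lemma doms_antis a k : doms a = antis (antidom k a).
Proof. by apply: funext => i; exact: antidom2 bA _ _ _ _. Qed.

(** The axiom for [a ;; antidom i b] at the tuple [antis a]: its domain factors
    disappear because all the [antidom j a] have the same domain tuple. *)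
Lemma antis_antidom a i b :
  antis a ;; antidom i b = antis (antis a ;; b) ;; antidom i a.
Proof.
rewrite (comp_antidom bA); congr (_ ;; _).
elim: (enum _) => //= j s ->.
by rewrite (doms_antis _ i0) (antidom2 bA i0 j i) -(doms_antis _ i0) (doms_comp bA).
Qed.

(** The source of idempotence and commutation: moving one guard past another
    only alters the element that the second one guards against. *)
Lemma antis_shift a b x :
  antis a ;; (antis b ;; x) = antis (antis a ;; b) ;; (antis a ;; x).
Proof.
rewrite -!(compA bA); congr (_ ;; _).
by apply: funext => i; exact: antis_antidom.
Qed.

Lemma antis_idem a x : antis a ;; (antis a ;; x) = antis a ;; x.
Proof. by rewrite antis_shift antis_comp (projs_comp bA). Qed.

Lemma doms_antis_comp a x : doms a ;; (antis a ;; x) = o.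
Proof.
rewrite -(compA bA); apply: (@comp_has_o _ i0).
by rewrite (doms_antis _ i0) antis_comp.
Qed.

(** Both sides are compared on the two parts cut out by [b]: on the domain of
    [b] both vanish, and off it the second guard is absorbed. *)
Lemma antis_comm a b x : antis a ;; (antis b ;; x) = antis b ;; (antis a ;; x).
Proof.
apply: (guards_separate bA (a := b)).
  rewrite (doms_antis _ i0) antis_shift -(doms_antis _ i0).
  by rewrite !doms_antis_comp comp_o.
by rewrite antis_shift !antis_idem -antis_shift.
Qed.

(** Finite products of guards are kept as lists, so that no element needs to be
    found whose guard is the product. *)
Definition act s x := foldr (fun a y => antis a ;; y) x s.

Lemma act_cat s t x : act (s ++ t) x = act s (act t x).
Proof. exact: foldr_cat. Qed.

Lemma antis_act a s x : antis a ;; act s x = act s (antis a ;; x).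
Proof. by elim: s => //= b s IHs; rewrite antis_comm IHs. Qed.

Lemma act_comm s t x : act s (act t x) = act t (act s x).
Proof. by elim: s => //= a s ->; rewrite antis_act. Qed.

Lemma act_comp s (a : 'I_n -> A) b : act s (a ;; b) = (fun i => act s (a i)) ;; b.
Proof. by elim: s => //= c s ->; rewrite -(compA bA). Qed.

Lemma act_o s : act s o = o.
Proof. by elim: s => //= a s ->; rewrite comp_o. Qed.

Lemma act_antis s x y : act s (antis x ;; y) = antis (act s x) ;; act s y.
Proof. by elim: s => //= a s ->; rewrite antis_shift. Qed.

(** * Ultrafilters of guards *)

(** The set [U] stands for the ultrafilter of the guards [antis a] with [a] in
    [U]; [antidom i a] represents the complement of the guard of [a], and the
    second condition says that no finite product of guards in [U] is zero. *)
Definition ultra U : Prop :=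
  (forall a i, U a \/ U (antidom i a)) /\
  (forall s, List.Forall U s -> exists x, act s x <> o).

Definition germ U x y : Prop := exists2 s, List.Forall U s & act s x = act s y.

Lemma germ_refl U x : germ U x x.
Proof. by exists [::]. Qed.

Lemma germ_sym U x y : germ U x y -> germ U y x.
Proof. by move=> [s Us xy]; exists s. Qed.

Lemma germ_trans U x y z : germ U x y -> germ U y z -> germ U x z.
Proof.
move=> [s Us xy] [t Ut yz]; exists (s ++ t); first exact/Forall_cat.
by rewrite !act_cat act_comm xy act_comm yz.
Qed.

(** Finitely many germ equalities have a common witness, the concatenation of
    the individual ones. *)
Lemma germ_tuple U (a b : 'I_n -> A) : (forall i, germ U (a i) (b i)) ->
  exists2 s, List.Forall U s & forall i, act s (a i) = act s (b i).
Proof.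
move=> ab; suff [s Us sab] : exists2 s, List.Forall U s &
    forall i, i \in enum 'I_n -> act s (a i) = act s (b i).
  by exists s => // i; apply: sab; rewrite mem_enum.
elim: (enum _) => [|j l [s Us sab]]; first by exists [::].
have [t Ut tab] := ab j.
exists (s ++ t); first exact/Forall_cat.
move=> i; rewrite inE !act_cat => /orP[/eqP->|/sab il]; first by rewrite tab.
by rewrite act_comm il act_comm.
Qed.

Lemma germ_comp U (a b : 'I_n -> A) f :
  (forall i, germ U (a i) (b i)) -> germ U (a ;; f) (b ;; f).
Proof.
move=> /germ_tuple[s Us sab]; exists s => //; rewrite !act_comp; congr (_ ;; _).
exact: funext.
Qed.

Lemma germ_antis U a x : U a -> germ U (antis a ;; x) x.
Proof. by move=> Ua; exists [:: a]; [constructor | exact: antis_idem]. Qed.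

Lemma antis_doms_comp a x : antis a ;; (doms a ;; x) = o.
Proof. by rewrite (doms_antis _ i0) antis_comm -doms_antis doms_antis_comp. Qed.

(** The zero germ means being undefined at [U].  If a product [s] of guards from
    [U] kills [a], it is disjoint from the domain of [a], whose guard therefore
    cannot lie in [U] by consistency. *)
Lemma ultra_germ_o U a : ultra U -> (U a <-> germ U a o).
Proof.
move=> [Ucov Ucons]; split=> [Ua|[s Us sa]].
  by exists [:: a]; [constructor | rewrite /= antis_comp comp_o].
have [//|Uda] := Ucov a i0.
have /Ucons[x []] : List.Forall U (s ++ [:: antidom i0 a]).
  by apply/Forall_cat; split=> //; do !constructor.
rewrite act_cat /= -doms_antis -[act s _](projs_comp bA w) -(act_o s) -sa.
by rewrite -act_antis antis_doms_comp sa act_o.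
Qed.

(** Repeated uses of the new guard merge, by commutation and idempotence, into a
    single application of it. *)
Lemma germ_insert U a x y :
  germ (fun z => U z \/ z = a) x y -> germ U (antis a ;; x) (antis a ;; y).
Proof.
move=> [s Us sxy].
have [t Ut tE] : exists2 t, List.Forall U t &
    forall z, act t (antis a ;; z) = antis a ;; act s z.
  elim: Us => [|c s' [Uc|->] _ [t Ut tE]]; first by exists [::].
    exists (c :: t); first by constructor.
    by move=> z; rewrite /= tE antis_comm.
  by exists t => // z; rewrite /= antis_idem.
by exists t; rewrite // !tE sxy.
Qed.

(** Let [U] be maximal among the sets of guards under which [b] and [c] keep
    distinct germs.  If [U] contained neither the guard of [a] nor its
    complement, adding either one would identify [b] and [c]; then they would
    agree on both parts cut out by [a], up to guards from [U], and so be
    identified at [U] already. *)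
Lemma separation b c : b <> c -> exists2 U, ultra U & ~ germ U b c.
Proof.
move=> bc.
have [|U [Ubc Umax]] := @Zorn_bigcup A (fun U => ~ germ U b c).
  move=> F FP Ftot [s Us].
  (* A finite list in the union of a chain lies in one member of it; the empty
     list is set apart because the chain may be empty. *)
  have [->//|[V FV Vs]] : s = [::] \/ exists2 V, F V & List.Forall V s.
    elim: Us => [|a t [V FV Va] _ [->|[W FW Wt]]]; first by left.
      by right; exists V => //; do !constructor.
    right; have [VW|WV] := Ftot V W FV FW.
      by exists W => //; constructor => //; exact: VW.
    exists V => //; constructor => //; by apply: List.Forall_impl Wt => z /WV.
  by move=> sbc; apply: (FP V FV); exists s.
have add a : ~ U a -> germ U (antis a ;; b) (antis a ;; c).
  move=> nUa; apply: germ_insert; apply: contrapT; apply: Umax.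
  split=> [z Uz|/(_ a)Ua]; first by left.
  by apply: nUa; apply: Ua; right.
exists U => //; split=> [a i|s Us].
  apply: contrapT => /not_orP[/add[s Us sbc] /add[t Ut]].
  rewrite -doms_antis => tbc; apply: Ubc; exists (s ++ t); first exact/Forall_cat.
  apply: (guards_separate bA (a := a)).
    by rewrite (doms_antis a i) !antis_act -(doms_antis a i) !act_cat tbc.
  by rewrite !antis_act !act_cat act_comm sbc act_comm.
apply: contrapT => /forallNP ns; apply: Ubc; exists s => //.
have so x : act s x = o by apply: contrapT; exact: ns.
by rewrite !so.
Qed.

(** * Restriction to a guard, seen at an ultrafilter *)

Lemma germ_has_o U (a : 'I_n -> A) i f : germ U (a i) o -> germ U (a ;; f) o.
Proof.
move=> [s Us sa]; exists s => //; rewrite act_comp act_o.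
by apply: (@comp_has_o _ i); rewrite sa act_o.
Qed.

(** Every guard in the expansion of [a ;; antidom i b] belongs to [U], hence
    acts trivially on germs. *)
Lemma germ_comp_antidom U (a : 'I_n -> A) i b : ultra U ->
  (forall j, ~ germ U (a j) o) -> germ U (a ;; b) o ->
  germ U (a ;; antidom i b) (a i).
Proof.
move=> uU da /(ultra_germ_o _ uU)Uab; rewrite (comp_antidom bA).
apply: germ_trans (germ_antis _ Uab) _.
elim: (enum _) => /= [|j l IHl]; first exact: germ_refl.
apply: germ_trans IHl; rewrite (doms_antis _ i0); apply: germ_antis.
have [+ _] := uU => /(_ (a j) i0)[|//].
by move/(ultra_germ_o _ uU)/da.
Qed.

(** The leading guard of that expansion is now complementary to a guard of
    [U]. *)
Lemma germ_comp_antidom_o U (a : 'I_n -> A) i b : ultra U ->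
  ~ germ U (a ;; b) o -> germ U (a ;; antidom i b) o.
Proof.
move=> uU dab; rewrite (comp_antidom bA).
have [+ _] := uU => /(_ (a ;; b) i0)[/(ultra_germ_o _ uU)//|Uab].
apply: germ_trans (germ_sym (germ_antis _ Uab)) _.
by rewrite -doms_antis doms_antis_comp; exact: germ_refl.
Qed.

(** As [fixset i f] is its own domain element, the first germ is an instance of
    [germ_comp_antidom]; so are the germs of all components of
    [a ;; doms (fixset i f)], which makes that restriction of [a] harmless in
    [a ;; doms (fixset i f) ;; f], that is, in [a ;; fixset i f]. *)
Lemma germ_fixset U (a : 'I_n -> A) i f : ultra U ->
  ~ germ U (a ;; fixset i f) o ->
  germ U (a ;; fixset i f) (a i) /\ germ U (a ;; f) (a i).
Proof.
move=> uU dF.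
have da j : ~ germ U (a j) o by move=> /germ_has_o/dF.
pose g := antidom i (fixset i f).
have ag : germ U (a ;; g) o.
  by apply: germ_comp_antidom_o.
have FE j : germ U (a ;; antidom j g) (a j) by exact: germ_comp_antidom.
have Fi : germ U (a ;; fixset i f) (a i) by rewrite -(dom_fixset bA); exact: FE.
split=> //; apply: germ_trans Fi; rewrite -(doms_fixset bA) -(compA bA).
apply: germ_comp => j; apply: germ_sym.
by rewrite (doms_antis _ i); exact: FE.
Qed.

(** A germ equality is a true equality after restricting the tuple [a] by guards
    from [U], and the quasiequation for fixsets applies to the restricted
    tuple. *)
Lemma germ_fixset_intro U (a : 'I_n -> A) i f :
  germ U (a ;; f) (a i) -> germ U (a ;; fixset i f) (a i).
Proof.
move=> [s Us sa]; exists s => //; rewrite act_comp.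
by apply: (comp_fixset bA (b := fun j => act s (a j))); rewrite -act_comp.
Qed.

(** * The representation *)

(** A nonzero germ is the class of its representatives, so that equal germs are
    equal points and [repr f] is single-valued. *)
Definition is_point (p : set A * set A) : Prop :=
  ultra p.1 /\ exists2 x, ~ germ p.1 x o & p.2 = germ p.1 x.

Definition point := {p | is_point p}.
Implicit Types p q : point.

Definition world p : set A := (sval p).1.
Definition germs p : set A := (sval p).2.

Lemma world_ultra p : ultra (world p).
Proof. by have [] := svalP p. Qed.

Lemma germs_nonempty p : exists x, germs p x.
Proof.
have [_ [x _ px]] := svalP p.
by exists x; rewrite /germs px; exact: germ_refl.
Qed.

Lemma germs_def p x : germs p x -> ~ germ (world p) x o.
Proof.
have [_ [y dy]] := svalP p; rewrite /germs => -> yx xo; apply: dy.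
exact: germ_trans yx xo.
Qed.

Lemma germs_germ p x y : germs p x -> germ (world p) x y <-> germs p y.
Proof.
have [_ [z _ zE]] := svalP p; rewrite /germs zE => zx; split=> [|zy].
  exact: germ_trans zx.
exact: germ_trans (germ_sym zx) zy.
Qed.

Lemma germs_inj p q x : world p = world q -> germs p x -> germs q x -> p = q.
Proof.
move=> pq px qx; apply: eq_sig_hprop => [? ? ?|]; first exact: Prop_irrelevance.
rewrite [sval p]surjective_pairing [sval q]surjective_pairing; congr pair => //.
apply/predeqP => y; apply: iff_trans (iff_sym (germs_germ y px)) _.
by rewrite pq; exact: germs_germ.
Qed.

Lemma point_of_germ U x : ultra U -> ~ germ U x o ->
  exists2 p, world p = U & germs p x.
Proof.
move=> uU dx; have Ux : is_point (U, germ U x) by split=> //; exists x.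
by exists (exist _ _ Ux) => //; exact: germ_refl.
Qed.

Definition repr f : nrel n point :=
  fun xz => (forall i, world (xz.1 i) = world xz.2) /\
    exists2 a : 'I_n -> A, forall i, germs (xz.1 i) (a i) & germs xz.2 (a ;; f).

(** Germs are compatible with composition, so the representatives of the
    arguments may be chosen at will. *)
Lemma reprE f (x : 'I_n -> point) z (a : 'I_n -> A) :
  (forall i, world (x i) = world z) -> (forall i, germs (x i) (a i)) ->
  repr f (x, z) <-> germs z (a ;; f).
Proof.
move=> xz xa; split=> [[_ [b /= xb zb]]|zf]; last by split=> //; exists a.
apply/(germs_germ _ zb); apply: germ_comp => i.
by rewrite -(xz i); exact/germs_germ.
Qed.

Lemma tuple_germs (x : 'I_n -> point) :
  exists a : 'I_n -> A, forall i, germs (x i) (a i).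
Proof.
have /choice[a xa] : forall i, exists a, germs (x i) a.
  by move=> i; exact: germs_nonempty.
by exists a.
Qed.

Definition same_world p q := world p = world q.

Lemma same_world_equiv : RelationClasses.Equivalence same_world.
Proof. by split=> [p|p q|p q r] //; rewrite /same_world => ->. Qed.

Lemma repr_pf f : partial_function (repr f).
Proof.
move=> x y z xy xz; have [a xa] := tuple_germs x.
have [xy1 _] := xy; have [xz1 _] := xz.
have ya := (reprE f xy1 xa).1 xy; have za := (reprE f xz1 xa).1 xz.
by apply: germs_inj ya za; rewrite -(xy1 i0) -(xz1 i0).
Qed.

Lemma repr_within f : within_classes same_world (repr f).
Proof. by move=> x y [xy _]; split=> // i j; rewrite /same_world (xy i) (xy j). Qed.

Lemma repr_defined f (x : 'I_n -> point) (a : 'I_n -> A) U : ultra U ->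
  (forall i, world (x i) = U) -> (forall i, germs (x i) (a i)) ->
  (exists y : point, repr f (x, y)) <-> ~ germ U (a ;; f) o.
Proof.
move=> uU xU xa; split=> [[y xy]|df].
  have [xy1 _] := xy; have ya := (reprE f xy1 xa).1 xy.
  by rewrite -(xU i0) xy1; exact: germs_def.
have [y yU ya] := point_of_germ uU df; exists y.
by apply/(reprE _ _ xa) => //= i; rewrite xU yU.
Qed.

Lemma repr_comp (f : 'I_n -> A) g :
  repr (f ;; g) = pf_comp (fun i => repr (f i)) (repr g).
Proof.
apply/predeqP => -[x z]; have [a xa] := tuple_germs x; split=> [xz|].
  have [xzw _] := xz; have za := (reprE _ xzw xa).1 xz.
  rewrite -(compA bA) in za.
  have df i : ~ germ (world z) (a ;; f i) o.
    by move=> fo; apply: germs_def za _; exact: (germ_has_o (i := i)).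
  have /choice[y yP] : forall i,
      exists y : point, world y = world z /\ germs y (a ;; f i).
    by move=> i; have [y] := point_of_germ (world_ultra z) (df i); exists y.
  exists y; split=> [i|].
    by apply/(reprE _ _ xa) => [j|]; rewrite /= ?xzw; case: (yP i).
  by apply/reprE; [move=> i | move=> i | exact: za]; case: (yP i).
move=> [y [/= xy yz]]; have [yzw _] := yz.
have xzw i : world (x i) = world z by have [-> _] := xy i0; rewrite yzw.
apply/(reprE _ xzw xa); rewrite -(compA bA).
apply/(reprE g yzw) => // i.
by apply/(reprE _ _ xa) => // j; rewrite xzw yzw.
Qed.

Lemma repr_antidom i f : repr (antidom i f) = pf_antidom same_world i (repr f).
Proof.
apply/predeqP => -[x z]; have [a xa] := tuple_germs x; split.
  move=> xz; have [/= xzw _] := xz; have za := (reprE _ xzw xa).1 xz.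
  have fo : germ (world z) (a ;; f) o.
    apply: contrapT => df; apply: germs_def za _.
    exact: germ_comp_antidom_o (world_ultra z) df.
  split; last split=> /=.
  - apply: germs_inj (esym (xzw i)) _ (xa i); apply/(germs_germ _ za).
    apply: germ_comp_antidom fo; first exact: world_ultra.
    by move=> j; rewrite -(xzw j); exact: germs_def.
  - by move=> j k; rewrite /same_world !xzw.
  - by rewrite (repr_defined _ (world_ultra z) xzw xa).
move=> [/= -> [xE nf]].
have xw j : world (x j) = world (x i) by exact: xE.
apply/(reprE _ xw xa); apply/(germs_germ _ (xa i)); apply: germ_sym.
apply: germ_comp_antidom; first exact: world_ultra.
  by move=> j; rewrite -(xw j); exact: germs_def.
by apply: contrapT => /(repr_defined _ (world_ultra (x i)) xw xa).
Qed.

Lemma repr_fixset i f : repr (fixset i f) = pf_fixset i (repr f).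
Proof.
apply/predeqP => -[x z]; have [a xa] := tuple_germs x; split.
  move=> xz; have [/= xzw _] := xz; have za := (reprE _ xzw xa).1 xz.
  have [Fi fi] := germ_fixset (world_ultra z) (germs_def za).
  have zi : germs z (a i) by exact/(germs_germ _ za).
  have zx : z = x i by apply: germs_inj zi (xa i).
  split=> //=; rewrite -zx; apply/(reprE _ xzw xa).
  by apply/(germs_germ _ zi); exact: germ_sym.
move=> [/= -> xi]; have [/= xw _] := xi; have fa := (reprE _ xw xa).1 xi.
apply/(reprE _ xw xa); apply/(germs_germ _ (xa i)); apply: germ_sym.
apply: germ_fixset_intro; apply: germ_sym; exact/(germs_germ _ (xa i)).
Qed.

(** The tuple of the germs of the projections is sent by [repr b] to the germ of
    [b], because the projections compose to the identity. *)
Lemma repr_inj b c : repr b = repr c -> b = c.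
Proof.
move=> bc; apply: contrapT => /separation[U uU Ubc].
wlog db : b c bc Ubc / ~ germ U b o.
  move=> IH; have [bo|] := pselect (germ U b o); last exact: IH Ubc.
  have [co|] := pselect (germ U c o).
    by apply: Ubc; apply: germ_trans bo (germ_sym co).
  by apply: IH (esym bc) _ => /germ_sym.
(* A projection with zero germ would make every germ zero, including that of
   [b]. *)
have dpi i : ~ germ U (antidom i o) o.
  by move=> /(germ_has_o (a := antis o) b); rewrite (projs_comp bA).
have /choice[x xP] : forall i, exists x : point, world x = U /\ germs x (antidom i o).
  by move=> i; have [x] := point_of_germ uU (dpi i); exists x.
have [z zU zb] := point_of_germ uU db.
have xz i : world (x i) = world z by rewrite zU; case: (xP i).
have xo i : germs (x i) (antis o i) by case: (xP i).
have /(reprE _ xz xo) : repr c (x, z).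
  by rewrite -bc; apply/(reprE _ xz xo); rewrite (projs_comp bA).
by rewrite (projs_comp bA) => zc; apply: Ubc; rewrite -zU; exact/(germs_germ _ zb).
Qed.

Lemma basis_representable : representable A.
Proof.
pose R : set (nrel n point) := fun r => exists f, r = repr f.
have RP f : R (repr f) by exists f.
unshelve epose (P := @PFAlgebra n point same_world same_world_equiv R _ _ _ _ _ _).
- by exists (repr w).
- by move=> _ [f ->]; exact: repr_pf.
- by move=> _ [f ->]; exact: repr_within.
- move=> F _ /choice[f /funext ->] [g ->]; exists (f ;; g).
  by rewrite repr_comp.
- by move=> i _ [f ->]; exists (antidom i f); rewrite repr_antidom.
- by move=> i _ [f ->]; exists (fixset i f); rewrite repr_fixset.
pose h : A -> algebra_of_pf P := fun f => exist _ (repr f) (RP f).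
have hE (r : algebra_of_pf P) f : repr f = sval r -> h f = r.
  by move=> fr; apply: eq_sig_hprop => [? ? ?|//]; exact: Prop_irrelevance.
exists P, h; split.
- have /choice[g gE] : forall r : algebra_of_pf P, exists f, sval r = repr f.
    by move=> r; exact: svalP r.
  exists g => [f|r]; last exact: hE.
  by apply: repr_inj; rewrite -gE.
- by move=> f g; apply: hE; exact: repr_comp.
- by move=> i f; apply: hE; exact: repr_antidom.
- by move=> i f; apply: hE; exact: repr_fixset.
Qed.

End Completeness.

Theorem theorem8p3 (n : nat) (n_gt0 : (0 < n)%N) :
  quasivariety (@representable n) /\
  finitely_axiomatised_by (@representable n) (axioms n).
Proof.
suff ax : finitely_axiomatised_by (@representable n) (axioms n).
  by split=> //; exists [set q | List.In q (axioms n)]%classic.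
pose i0 : 'I_n := Ordinal n_gt0.
move=> A; split=> [[P [h hI]] q|Aax].
  have /basisP Bax := pf_basis i0 P.
  by move=> qax; apply: (satisfies_isomorphism hI); exact: Bax.
have [w] := carrier_nonempty A.
by apply: (basis_representable i0 w); apply/basisP => q; exact: Aax.
Qed.
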